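(* For each $\wp \in [1, \infty]$ there exists an additive metric space whose generalized roundness is $\wp$.
   Context: A metric $d$ on a set $X$ is additive if for all $x,y,z,w \in X$ we have $d(x,y) + d(z,w) \le \max\{d(x,z) + d(y,w),\, d(x,w) + d(y,z)\}$. A real number $p \ge 0$ is a generalized roundness exponent of a metric space $(X,d)$ if for all integers $n > 0$ and all choices of (not necessarily distinct) points $a_1, \ldots, a_n, b_1, \ldots, b_n \in X$ we have $\sum_{1 \le k < l \le n} \{ d(a_k,a_l)^p + d(b_k,b_l)^p \} \le \sum_{1 \le j,i \le n} d(a_j,b_i)^p$. The generalized roundness of $(X,d)$ is the supremum (in $[0,\infty]$) of the set of all generalized roundness exponents of $(X,d)$. For $p=0$ the convention $0^0 = 0$ is used for distances. *)

(* Defs.v *)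
From HB Require Import structures.
From mathcomp Require Import all_boot all_order all_algebra.
From mathcomp Require Import all_classical all_reals all_analysis.

Set Implicit Arguments.
Unset Strict Implicit.
Unset Printing Implicit Defensive.

Import Order.TTheory GRing.Theory Num.Theory.
Local Open Scope classical_set_scope.
Local Open Scope ring_scope.

Definition additive_metric (R : realType) (X : metricType R) : Prop :=
  forall x y z w : X,
    mdist x y + mdist z w <=
    Num.max (mdist x z + mdist y w) (mdist x w + mdist y z).

(* The library's powR satisfies 0 `^ 0 = 1, whereas distances are raised to
   powers with the convention 0 ^ 0 = 0; the two agree for nonzero t or p. *)
Definition dist_pow (R : realType) (t p : R) : R :=
  if t == 0 then 0 else t `^ p.

Definition roundness_exponent (R : realType) (X : metricType R) (p : R) : Prop :=
  0 <= p /\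
  forall (n : nat) (a b : 'I_n -> X), (0 < n)%N ->
    \sum_(k < n) \sum_(l < n | (k < l)%N)
      (dist_pow (mdist (a k) (a l)) p + dist_pow (mdist (b k) (b l)) p)
    <= \sum_(j < n) \sum_(i < n) dist_pow (mdist (a j) (b i)) p.

(* Since 0 is always an exponent, this supremum lies in [0, +oo] (the value
   -oo of the supremum of the empty set does not occur). *)
Definition generalized_roundness (R : realType) (X : metricType R) : \bar R :=
  ereal_sup [set p%:E | p in [set p : R | roundness_exponent X p]].

(* Main.v *)
Require Import Defs.
From HB Require Import structures.
From mathcomp Require Import all_boot all_order all_algebra.
From mathcomp Require Import all_classical all_reals all_analysis.
From mathcomp Require Import ring lra.

Set Implicit Arguments.
Unset Strict Implicit.
Unset Printing Implicit Defensive.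

Import Order.TTheory GRing.Theory Num.Theory.
Local Open Scope ring_scope.

(** Take countably many leaves at mutual distance 1 and one further point, the
    hub, at the same distance c from every leaf, where 1/2 <= c <= 1. This is a
    star metric: a centre, legs of length 1/2 to the leaves and a leg of length
    c - 1/2 to the hub, the distance of two distinct points being the sum of
    their legs. Every star metric with nonnegative legs is additive
    ([star_dist_four_point]).

    The family is closed under taking powers: raising all distances to the
    power p keeps the leaves at mutual distance 1 and replaces c by c^p
    ([dist_pow_hub]). The roundness inequality for the exponent p is therefore
    the inequality for the exponent 1 in the star with hub distance g = c^p,
    and this holds exactly when g >= 1/2.

    - If g >= 1/2, the legs are nonnegative, and a star metric is a nonnegative
      combination of the cuts separating one point from all the others
      ([star_dist_cut]). A cut is the squared distance of an embedding into
      {0, 1}, and for squared differences of real numbers the right side of the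
      roundness inequality exceeds the left by (sum u - sum v)^2
      ([sqr_diff_roundness]).
    - Conversely, n distinct leaves against n copies of the hub give
      n (n - 1) / 2 <= n^2 g, and letting n grow yields g >= 1/2
      ([hub_leaves_bound]). Infinitely many leaves are what makes the threshold
      exactly 1/2.

    Hence p >= 0 is an exponent if and only if c^p >= 1/2. With c = 2^(-q) for
    0 <= q <= 1 this reads q p <= 1, so the generalized roundness is 1/q, or
    infinity when q = 0; this exhausts [1, oo]. *)

(** * The roundness inequality for squared differences *)

Lemma sum_sym_lt (R : pzRingType) (n : nat) (F : 'I_n -> 'I_n -> R) :
  (forall k l, F k l = F l k) -> (forall k, F k k = 0) ->
  \sum_(k < n) \sum_(l < n) F k l =
    2 * \sum_(k < n) \sum_(l < n | (k < l)%N) F k l.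
Proof.
move=> Fsym F0; pose U := \sum_(k < n) \sum_(l < n | (k < l)%N) F k l.
have -> : \sum_(k < n) \sum_(l < n) F k l =
    U + \sum_(k < n) \sum_(l < n | (l < k)%N) F k l.
  rewrite -big_split /=; apply: eq_bigr => k _.
  rewrite [LHS](bigID (fun l : 'I_n => (k < l)%N)) /=; congr (_ + _).
  rewrite (bigD1 k) ?ltnn //= F0 add0r; apply: eq_bigl => l.
  by rewrite -leqNgt ltn_neqAle andbC.
rewrite (exchange_big_dep xpredT) //= -/U mulr_natl mulr2n; congr (_ + _).
by apply: eq_bigr => k _; apply: eq_bigr => l _; rewrite Fsym.
Qed.

Lemma sum_sqr_diff (R : realDomainType) (n : nat) (u v : 'I_n -> R) :
  \sum_(j < n) \sum_(i < n) (u j - v i) ^+ 2 =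
  n%:R * (\sum_i u i ^+ 2) + n%:R * (\sum_i v i ^+ 2)
    - 2 * ((\sum_i u i) * \sum_i v i).
Proof.
have inner j : \sum_(i < n) (u j - v i) ^+ 2 =
    n%:R * u j ^+ 2 + \sum_i v i ^+ 2 - 2 * (u j * \sum_i v i).
  rewrite mulr_sumr mulr_sumr -sumrN.
  have -> : n%:R * u j ^+ 2 = \sum_(i < n) u j ^+ 2.
    by rewrite sumr_const card_ord mulr_natl.
  by rewrite -!big_split; apply: eq_bigr => i _ /=; ring.
rewrite (eq_bigr _ (fun j _ => inner j)) !big_split /= sumr_const card_ord.
by rewrite -mulr_sumr sumrN -mulr_sumr -mulr_suml !mulr_natl.
Qed.

(** After doubling, the sums over pairs k < l become full double sums, and the
    two sides differ by (sum u - sum v)^2. *)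
Lemma sqr_diff_roundness (R : realDomainType) (n : nat) (u v : 'I_n -> R) :
  \sum_(k < n) \sum_(l < n | (k < l)%N)
      ((u k - u l) ^+ 2 + (v k - v l) ^+ 2)
  <= \sum_(j < n) \sum_(i < n) (u j - v i) ^+ 2.
Proof.
rewrite -(ler_pM2l (ltr0Sn R 1)) -sum_sym_lt; first last.
- by move=> k; rewrite !subrr expr0n addr0.
- by move=> k l; congr (_ + _); rewrite -sqrrN opprB.
under eq_bigr do rewrite big_split /=.
rewrite big_split /= !sum_sqr_diff -subr_ge0.
have := sqr_ge0 (\sum_i u i - \sum_i v i).
nra.
Qed.

(** * Star metrics *)

Section Star.
Context {R : realFieldType}.

(** The path metric of a star in which the point x hangs on a leg of length
    [f x]. *)
Definition star_dist {T : eqType} (f : T -> R) (x y : T) : R :=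
  if x == y then 0 else f x + f y.

Lemma star_distxx (T : eqType) (f : T -> R) x : star_dist f x x = 0.
Proof. by rewrite /star_dist eqxx. Qed.

Lemma star_dist_sym (T : eqType) (f : T -> R) x y :
  star_dist f x y = star_dist f y x.
Proof. by rewrite /star_dist eq_sym addrC. Qed.

(** Two distinct points x and y are separated by exactly the two cuts that
    isolate x and y. The points live in an arbitrary type, so the cuts are
    indexed by a finite list containing the points at hand. *)
Lemma star_dist_cut (T : eqType) (f : T -> R) (s : seq T) x y :
  uniq s -> x \in s -> y \in s ->
  star_dist f x y = \sum_(z <- s) f z * ((x == z)%:R - (y == z)%:R) ^+ 2.
Proof.
move=> us xs ys; rewrite /star_dist; case: eqVneq => [->|xy].
  by rewrite big1 // => z _; rewrite subrr expr0n mulr0.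
have leg t : t \in s -> f t = \sum_(z <- s) f z * (t == z)%:R.
  move=> ts; rewrite (bigD1_seq t) //= eqxx mulr1 big1 ?addr0 // => z.
  by rewrite eq_sym => /negbTE ->; rewrite mulr0.
rewrite [in LHS](leg x xs) [in LHS](leg y ys) -big_split /=.
apply: eq_bigr => z _; case: (eqVneq x z) xy => [-> zy|_ _].
  by rewrite eq_sym (negbTE zy) !mulr1 mulr0 subr0 expr1n mulr1 addr0.
by rewrite mulr0 add0r sub0r sqrrN; case: (y == z); rewrite ?expr1n ?expr0n.
Qed.

Lemma star_roundness (T : eqType) (f : T -> R) (n : nat) (a b : 'I_n -> T) :
  (forall x, 0 <= f x) ->
  \sum_(k < n) \sum_(l < n | (k < l)%N)
      (star_dist f (a k) (a l) + star_dist f (b k) (b l))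
  <= \sum_(j < n) \sum_(i < n) star_dist f (a j) (b i).
Proof.
move=> f0; pose s := undup (codom a ++ codom b).
have us : uniq s by exact: undup_uniq.
have sa k : a k \in s by rewrite mem_undup mem_cat codom_f.
have sb k : b k \in s by rewrite mem_undup mem_cat codom_f orbT.
pose u z k : R := (a k == z)%:R; pose v z k : R := (b k == z)%:R.
have -> : \sum_(j < n) \sum_(i < n) star_dist f (a j) (b i) =
    \sum_(z <- s) f z * \sum_(j < n) \sum_(i < n) (u z j - v z i) ^+ 2.
  under eq_bigr do under eq_bigr do rewrite (star_dist_cut f us) //.
  under eq_bigr do rewrite exchange_big /=.
  rewrite exchange_big /=; apply: eq_bigr => z _; rewrite mulr_sumr.
  by apply: eq_bigr => j _; rewrite mulr_sumr.
have -> : \sum_(k < n) \sum_(l < n | (k < l)%N)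
      (star_dist f (a k) (a l) + star_dist f (b k) (b l)) =
    \sum_(z <- s) f z * \sum_(k < n) \sum_(l < n | (k < l)%N)
      ((u z k - u z l) ^+ 2 + (v z k - v z l) ^+ 2).
  under eq_bigr do under eq_bigr do
    rewrite !(star_dist_cut f us) // -big_split /=.
  under eq_bigr do rewrite exchange_big /=.
  rewrite exchange_big /=; apply: eq_bigr => z _; rewrite mulr_sumr.
  apply: eq_bigr => k _; rewrite mulr_sumr.
  by apply: eq_bigr => l _; rewrite mulrDr.
by apply: ler_sum => z _; apply: ler_wpM2l => //; exact: sqr_diff_roundness.
Qed.

(** When the four points are distinct, all three sums equal the total length of
    the four legs. *)
Lemma star_dist_four_point (T : eqType) (f : T -> R) (x y z w : T) :
  (forall t, 0 <= f t) ->
  star_dist f x y + star_dist f z w <=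
  Num.max (star_dist f x z + star_dist f y w)
          (star_dist f x w + star_dist f y z).
Proof.
move=> f0; have [fx fy fz fw] := And4 (f0 x) (f0 y) (f0 z) (f0 w).
rewrite /star_dist le_max; apply/orP.
have [xy|xy] := eqVneq x y; have [zw|zw] := eqVneq z w;
have [xz|xz] := eqVneq x z; have [yw|yw] := eqVneq y w;
have [xw|xw] := eqVneq x w; have [yz|yz] := eqVneq y z;
subst; try (by match goal with H : is_true (?t != ?t) |- _ =>
  rewrite eqxx in H end);
first [left; lra|right; lra].
Qed.

(** The four-point condition with a repeated point. *)
Lemma star_dist_triangle (T : eqType) (f : T -> R) :
  (forall t, 0 <= f t) ->
  forall y x z, star_dist f x z <= star_dist f x y + star_dist f y z.
Proof.
move=> f0 y x z; have := star_dist_four_point x z y y f0.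
by rewrite star_distxx addr0 maxxx (star_dist_sym f z).
Qed.

Lemma star_dist_eq0 (T : eqType) (f : T -> R) :
  (forall x y, x != y -> 0 < f x + f y) ->
  forall x y, star_dist f x y = 0 -> x = y.
Proof.
move=> f_gt0 x y; rewrite /star_dist; case: eqVneq => // xy /eqP.
by rewrite gt_eqF ?f_gt0.
Qed.

(** The conditions on the legs are arguments of this copy of [T] so that the
    metric structure attached to it can use them. A leg of length 0 is
    allowed, at most once: the centre of the star may be one of the points. *)
Definition star_space {T : choiceType} {f : T -> R}
  (f_ge0 : forall x, 0 <= f x)
  (f_gt0 : forall x y, x != y -> 0 < f x + f y) : Type := T.

HB.instance Definition _ (T : choiceType) (f : T -> R) f_ge0 f_gt0 :=
  Choice.on (@star_space T f f_ge0 f_gt0).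

HB.instance Definition _ (T : choiceType) (f : T -> R) f_ge0 f_gt0 :=
  @isMetric.Build R (@star_space T f f_ge0 f_gt0) (@star_dist T f)
    (star_distxx f) (star_dist_eq0 f_gt0) (star_dist_sym f)
    (star_dist_triangle f_ge0).

End Star.

(** * The hub space *)

Section Hub.
Context {R : realType}.

(** [None] is the hub, at distance c from each leaf [Some i]. *)
Definition hub_leg (c : R) (x : option nat) : R :=
  if x is Some _ then 2^-1 else c - 2^-1.

Lemma hub_leg_ge0 c : 2^-1 <= c -> forall x, 0 <= hub_leg c x.
Proof. by move=> c2 [?|] /=; lra. Qed.

Lemma hub_leg_gt0 c : 2^-1 <= c ->
  forall x y, x != y -> 0 < hub_leg c x + hub_leg c y.
Proof. by move=> c2 [?|] [?|] //= _; lra. Qed.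

Definition hub_space c (c2 : 2^-1 <= c) : metricType R :=
  star_space (hub_leg_ge0 c2) (hub_leg_gt0 c2).

Lemma hub_mdistE c (c2 : 2^-1 <= c) (x y : hub_space c2) :
  mdist x y = star_dist (hub_leg c) x y.
Proof. by []. Qed.

(** Distances between leaves are 1, hence unchanged by powers, so a power of a
    hub metric is a hub metric. *)
Lemma dist_pow_hub c p x y : 0 < c ->
  dist_pow (star_dist (hub_leg c) x y) p = star_dist (hub_leg (c `^ p)) x y.
Proof.
move=> c0; have hh : 2^-1 + 2^-1 = 1 :> R by lra.
rewrite /star_dist; case: eqVneq => [_|]; first by rewrite /dist_pow eqxx.
case: x y => [i|] [j|] //= _; rewrite /dist_pow.
- by rewrite hh oner_eq0 powR1.
- by rewrite !(addrC 2^-1) !subrK gt_eqF.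
- by rewrite !subrK gt_eqF.
Qed.

(** The test configurations are n distinct leaves against n copies of the hub;
    they give n - 1 <= 2 n g, which fails for n > 1 / (1 - 2 g) if g < 1/2. *)
Lemma hub_leaves_bound (g : R) :
  (forall (n : nat) (a b : 'I_n -> option nat), (0 < n)%N ->
    \sum_(k < n) \sum_(l < n | (k < l)%N)
      (star_dist (hub_leg g) (a k) (a l) + star_dist (hub_leg g) (b k) (b l))
    <= \sum_(j < n) \sum_(i < n) star_dist (hub_leg g) (a j) (b i)) ->
  2^-1 <= g.
Proof.
move=> H; have leaves n : (0 < n)%N -> n%:R - 1 <= 2 * (n%:R * g).
  move=> n0; pose F (k l : 'I_n) : R := 1 - (k == l)%:R.
  have leafE (k l : 'I_n) : star_dist (hub_leg g) (Some (k : nat)) (Some (l : nat)) +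
      star_dist (hub_leg g) None None = F k l.
    rewrite /star_dist eqxx addr0 /F (inj_eq Some_inj) (inj_eq val_inj).
    by case: (k == l); rewrite ?subrr // subr0 /=; lra.
  have rowF (k : 'I_n) : \sum_(l < n) F k l = n%:R - 1.
    rewrite big_split /= sumr_const card_ord (bigD1 k) //= eqxx big1 ?addr0 //.
    by move=> l lk; rewrite eq_sym (negbTE lk) oppr0.
  have Fsym k l : F k l = F l k by rewrite /F eq_sym.
  have F0 k : F k k = 0 by rewrite /F eqxx subrr.
  have := H n (fun k : 'I_n => Some (k : nat)) (fun=> None) n0.
  rewrite (eq_bigr (fun k : 'I_n => \sum_(l < n | (k < l)%N) F k l)); last first.
    by move=> k _; apply: eq_bigr => l _; exact: leafE.
  rewrite [leRHS](eq_bigr (fun=> n%:R * g)); last first.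
    move=> k _; rewrite /star_dist /= sumr_const card_ord mulr_natl.
    by rewrite addrC subrK.
  rewrite -(ler_pM2l (ltr0Sn R 1)) -(sum_sym_lt Fsym F0).
  rewrite (eq_bigr _ (fun k _ => rowF k)) !sumr_const !card_ord.
  by rewrite mulrnAr lerMn2r eqn0Ngt n0.
rewrite leNgt; apply/negP => g2; have {}g2 : 0 < 1 - 2 * g by lra.
pose n := Num.truncn (1 - 2 * g)^-1.
have := truncnS_gt (1 - 2 * g)^-1; rewrite -/n -[ltLHS]div1r ltr_pdivrMr //.
have := leaves n.+1 isT; set N : R := n.+1%:R => leN ltN; nra.
Qed.

Lemma hub_roundness_exponentP c (c2 : 2^-1 <= c) p :
  roundness_exponent (hub_space c2) p <-> 0 <= p /\ 2^-1 <= c `^ p.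
Proof.
have c0 : 0 < c by lra.
split=> -[p0 H]; split => //; last first.
  move=> n a b _.
  under eq_bigr do under eq_bigr do rewrite !hub_mdistE !dist_pow_hub //.
  under [leRHS]eq_bigr do under eq_bigr do rewrite hub_mdistE dist_pow_hub //.
  by apply: star_roundness; exact: hub_leg_ge0.
apply: hub_leaves_bound => n a b n0; have := H n a b n0.
under eq_bigr do under eq_bigr do rewrite !hub_mdistE !dist_pow_hub //.
by under [leRHS]eq_bigr do under eq_bigr do rewrite hub_mdistE dist_pow_hub //.
Qed.

Lemma hub_space_additive c (c2 : 2^-1 <= c) : additive_metric (hub_space c2).
Proof. by move=> x y z w; apply: star_dist_four_point; exact: hub_leg_ge0. Qed.

(** Taking q, the inverse of the prescribed roundness, as the parameter treats
    finite and infinite roundness uniformly; the hub distance is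
    c = 2^(-q). *)
Lemma additive_space_exponents (q : R) : 0 <= q <= 1 ->
  exists X : metricType R, additive_metric X /\
    forall p, roundness_exponent X p <-> 0 <= p /\ q * p <= 1.
Proof.
move=> /andP[q0 q1]; have L0 : 0 < ln (2 : R) by apply: ln_gt0; lra.
have half : 2^-1 = expR (- ln 2) :> R by rewrite expRN lnK // posrE.
have c2 : 2^-1 <= expR (- ln 2 * q) :> R by rewrite half ler_expR; nra.
exists (hub_space c2); split; first exact: hub_space_additive.
move=> p; rewrite hub_roundness_exponentP -expRM half ler_expR.
by rewrite -mulrA mulNr lerN2 ger_pMr.
Qed.

End Hub.

(** * Every value in [1, oo] is attained *)

Theorem corollary5p2 (R : realType) (r : \bar R) (hr : (1%:E <= r)%E) :
  exists X : metricType R, additive_metric X /\ generalized_roundness X = r.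
Proof.
case: r hr => [r| |] //; last first.
  move=> _; have [|X [addX expX]] := @additive_space_exponents R 0.
    by rewrite lexx ler01.
  exists X; split=> //; apply/eqyP => p /ltW p0.
  apply: ereal_sup_ubound; exists p => //.
  by apply/expX; rewrite mul0r ler01.
rewrite lee_fin => r1; have r0 : 0 < r by lra.
have [|X [addX expX]] := @additive_space_exponents R r^-1.
  by rewrite invr_ge0 (ltW r0) invf_le1.
exists X; split=> //; apply/eqP; rewrite eq_le; apply/andP; split.
  apply: ge_ereal_sup => _ [p /expX [_ pr] <-]; rewrite lee_fin.
  by rewrite mulrC ler_pdivrMr // mul1r in pr.
apply: ereal_sup_ubound; exists r => //; apply/expX.
by rewrite (ltW r0) mulVf ?gt_eqF.
Qed.
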